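(* Let $(\Theta,d_\Theta)$ be a metric space for which there exists a sequence $\{\Theta_n\}_{n\in\mathbb{N}}$ of totally bounded open subsets of $\Theta$ with $\Theta_n\subseteq\Theta_{n+1}$ for $n\in\mathbb{N}$, $\Theta=\bigcup_{n\in\mathbb{N}}\Theta_n$, and constants $C_n,t_n>0$ ($n\in\mathbb{N}$) such that $$N(\Theta_n,d_\Theta,\eta)\le C_n\eta^{-t_n}\quad\text{for all }n\in\mathbb{N},\ \eta\in\,]0,\Delta(\Theta_n)].$$ Let $(\mathcal{X},d_{\mathcal{X}})$ be a complete metric space and let $(X_\theta)_{\theta\in\Theta}$ be an $\mathcal{X}$-valued random process on a probability space $(\Omega,\mathcal{F},\mathbb{P})$ such that $(X_\theta,X_\vartheta)$ is $\mathcal{F}|\mathcal{B}(\mathcal{X}^2)$-measurable for all $(\theta,\vartheta)\in\Theta^2$ with $\theta\ne\vartheta$. Assume that, for all $n\in\mathbb{N}$, there exist $M_n,p_n,\rho_n>0$ and $q_n>t_n$ such that $$\mathbb{E}\big[d_{\mathcal{X}}(X_\theta,X_\vartheta)^{p_n}\big]\le M_n\,d_\Theta(\theta,\vartheta)^{q_n}\quad\text{for }\theta,\vartheta\in\Theta_n\text{ with }d_\Theta(\theta,\vartheta)<\rho_n.$$ Then $(X_\theta)_{\theta\in\Theta}$ has a modification $(\widetilde X_\theta)_{\theta\in\Theta}$ such that $(\widetilde X_\theta,\widetilde X_\vartheta)$ is $\mathcal{F}|\mathcal{B}(\mathcal{X}^2)$-measurable for all $\theta\ne\vartheta$ in $\Theta$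 and all its paths are locally Hölder-continuous of all orders $\beta\in\bigcap_{n\in\mathbb{N}}[0,(q_n-t_n)/p_n[$, where ''Hölder-continuous of order $0$'' is understood as ''uniformly continuous''. Moreover, for $n\in\mathbb{N}$ and $\overline{\theta}\in\Theta_n$, there is a neighbourhood $V(\overline{\theta})$ of $\overline{\theta}$, open in $\Theta$, such that $$\mathbb{E}\left[\sup_{\theta,\vartheta\in V(\overline{\theta}),\ \theta\neq\vartheta}\frac{d_{\mathcal{X}}(\widetilde X_\theta,\widetilde X_\vartheta)^{p_n}}{d_\Theta(\theta,\vartheta)^{\beta p_n}}\right]<\infty\quad\text{for all }\beta\in[0,(q_n-t_n)/p_n[.$$
   Context: For a subset $S$ of $\Theta$, $\Delta(S)$ is its diameter w.r.t. $d_\Theta$, and $N(S,d_\Theta,\eta)$ is the minimal number of closed $d_\Theta$-balls of radius $\eta>0$ with centers in $S$ needed to cover $S$. $\mathcal{B}(\cdot)$ denotes the Borel $\sigma$-algebra, and $\mathcal{X}^2$ carries the product topology. An $\mathcal{X}$-valued random process is a family of $\mathcal{F}|\mathcal{B}(\mathcal{X})$-measurable maps $X_\theta:\Omega\to\mathcal{X}$, $\theta\in\Theta$. A modification of $(X_\theta)_{\theta\in\Theta}$ is a process $(\widetilde X_\theta)_{\theta\in\Theta}$ with $\mathbb{P}(\widetilde X_\theta=X_\theta)=1$ for every $\theta\in\Theta$. A path is locally Hölder-continuous of order $\beta$ if each point of $\Theta$ has a neighbourhood on which the path is Hölder-continuous of order $\beta$. $[a,b[$ and $]a,b]$ denote half-open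 intervals. A supremum over the empty set is $0$ here. *)

(* Defs.v *)
From HB Require Import structures.
From mathcomp Require Import all_boot all_order all_algebra.
From mathcomp Require Import all_classical all_reals all_analysis.
From mathcomp Require Import measurable_realfun.

Set Implicit Arguments.
Unset Strict Implicit.
Unset Printing Implicit Defensive.

Import Order.TTheory GRing.Theory Num.Theory.
Import numFieldNormedType.Exports.

Local Open Scope classical_set_scope.
Local Open Scope ring_scope.

(* Supremum in [0, +oo] of a set of nonnegative reals: the added 0 implements
   the convention sup set0 = 0 (ereal_sup set0 is -oo). *)
Definition sup0 {R : realType} (A : set R) : \bar R :=
  ereal_sup (0%E |` (EFin @` A)).

Section metric_notions.
Context {R : realType}.

(* mathcomp-analysis' [closed_ball] is the closure of the open ball, which may
   be strictly smaller than this set in a general metric space. *)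
Definition closed_mball {T : metricType R} (x : T) (r : R) : set T :=
  [set y | mdist x y <= r].

Definition diam {T : metricType R} (S : set T) : \bar R :=
  sup0 [set mdist x y | x in S & y in S].

(* +oo if no finite cover exists; the centers are listed by a finite sequence,
   so that the infimum is attained otherwise. *)
Definition covering_number {T : metricType R} (S : set T) (eta : R) : \bar R :=
  ereal_inf [set ((size s)%:R : R)%:E | s in
    [set s : seq T | [set` s] `<=` S /\
                     S `<=` \bigcup_(c in [set` s]) closed_mball c eta]].

Definition totally_bounded {T : metricType R} (S : set T) : Prop :=
  forall e : R, 0 < e -> exists s : seq T,
    [set` s] `<=` S /\ S `<=` \bigcup_(c in [set` s]) ball c e.

(* The library's [completeType] additionally requires a distinguished point. *)
Definition complete_metric (T : metricType R) : Prop :=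
  forall u : nat -> T, cauchy (u @ \oo) -> exists x : T, u @ \oo --> x.

(* Order 0 means uniform continuity, not boundedness of the oscillation. *)
Definition hoelder_on {T U : metricType R} (beta : R) (V : set T) (f : T -> U)
    : Prop :=
  if beta == 0 then
    forall e : R, 0 < e -> exists2 r : R, 0 < r &
      forall x y, V x -> V y -> mdist x y < r -> mdist (f x) (f y) < e
  else
    exists L : R, forall x y, V x -> V y ->
      mdist (f x) (f y) <= L * mdist x y `^ beta.

Definition locally_hoelder {T U : metricType R} (beta : R) (f : T -> U) : Prop :=
  forall x : T, exists2 V : set T, nbhs x V & hoelder_on beta V f.

Definition hoelder_quotient_sup {T U : metricType R} (V : set T) (beta p : R)
    (f : T -> U) : \bar R :=
  sup0 [set r | exists x y, [/\ V x, V y, x <> y &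
    r = mdist (f x) (f y) `^ p / mdist x y `^ (beta * p)]].

End metric_notions.

(* F|B(T)-measurability. *)
Definition borel_measurable {d : measure_display} {Omega : measurableType d}
    {T : topologicalType} (f : Omega -> T) : Prop :=
  forall B : set T, <<s @open T >> B -> measurable (f @^-1` B).

Definition random_process {d : measure_display} {Omega : measurableType d}
    {I : Type} {T : topologicalType} (X : I -> Omega -> T) : Prop :=
  forall i, borel_measurable (X i).

(* On [T * T] the canonical topology is the product topology. *)
Definition pairwise_measurable {d : measure_display} {Omega : measurableType d}
    {I : Type} {T : topologicalType} (X : I -> Omega -> T) : Prop :=
  forall i j, i <> j -> borel_measurable (fun w => (X i w, X j w)).

(* The event is required to be measurable since, for a general T, this does not
   follow from the measurability of both processes. *)
Definition modification {d : measure_display} {Omega : measurableType d}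
    {R : realType} {I : Type} {T : topologicalType} (P : probability Omega R)
    (Y X : I -> Omega -> T) : Prop :=
  random_process Y /\
  forall i, measurable [set w | Y i w = X i w] /\
            P [set w | Y i w = X i w] = 1%E.

(* Main.v *)
Require Import Defs.
From HB Require Import structures.
From mathcomp Require Import all_boot all_order all_algebra.
From mathcomp Require Import all_classical all_reals all_analysis.
From mathcomp Require Import measurable_realfun.
From mathcomp Require Import ring lra.

(** The proof is a chaining argument, made pointwise.

    Fix [n] and cover [Theta_ n] by nets [A k] of scale [eta0 / 2 ^+ k]. A
    continuity modulus follows as soon as the increments of the process are
    under control along links between consecutive nets and between near points
    of the same net. There are polynomially many links of the first kind, with
    the exponent [t n] of the covering bound. The near pairs in [A k] could be
    as many as the square of its size, which the condition [t n < q n] would not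
    afford; but at the price of a constant factor in their length, a subfamily
    of size [eta `^ (- (t n + eps))] suffices, for any [eps > 0]
    ([sparse_links], [near_links]).

    Let [W] be the sum over all links of the [p n]-th powers of the increments,
    with the weight [eta `^ (- (beta * p n))] at scale [eta]. The moment
    condition makes [W] integrable when [beta < (q n - t n) / p n], and where
    [W] is finite, chaining ([chaining_bound]) gives the Hölder estimate
    [mdist (X x) (X y) `^ p n <= W * mdist x y `^ (beta * p n)] up to a
    constant, for all close [x] and [y] in the union of the nets. The nets may
    be chosen to contain any given sequence of points, whence
    [hoelder_moment], the core of the proof.

    Apply it to a dense sequence [e] of [Theta], to all [n], and to countably
    many exponents. Off a null set all the majorants [W] are finite; on the null
    set the process is replaced by a constant. The restriction to the dense
    sequence then extends to [Theta] by completeness, with the same estimates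
    ([hoelder_extension]); they give the local Hölder continuity, and the
    majorant of the supremum in the last assertion is [W] itself. Applying
    [hoelder_moment] once more, to the sequence obtained by adding one point
    [u] in front of [e], shows that the original process at [u] is almost surely
    the limit that defines the extension, hence that the latter is a
    modification. Pairs of values stay measurable because pointwise limits
    of Borel functions into a pseudometric space are Borel, also when the product
    of [X] with itself carries more Borel sets than the product sigma-algebra. *)

Set Implicit Arguments.
Unset Strict Implicit.
Unset Printing Implicit Defensive.

Import Order.TTheory GRing.Theory Num.Theory.
Import numFieldNormedType.Exports.

Local Open Scope classical_set_scope.
Local Open Scope ring_scope.

(** * Sparse families of links in finite metric spaces *)

Section links.
Context {R : realType} {T : metricType R}.
Implicit Types (s : seq T) (c a : R) (k : nat).

(** Otherwise the count would be multiplied by more than [a] at each of the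
    [k.+1] steps, and exceed the size of [s]. *)
Lemma ball_growth k c a (x0 : T) s : x0 \in s -> 0 <= c -> 0 <= a ->
  (size s)%:R <= a ^+ k.+1 ->
  exists2 l, (l <= k)%N &
    (count (fun y => mdist x0 y <= l.+1%:R * c) s)%:R <=
    a * (count (fun y => mdist x0 y <= l%:R * c) s)%:R.
Proof.
move=> x0s c0 a0 sa; apply: contrapT => /forall2NP hl.
pose b l := count (fun y => mdist x0 y <= l%:R * c) s.
have b0 : (1%N <= b 0%N)%N.
  by rewrite /b -has_count; apply/hasP; exists x0 => //; rewrite mul0r mdistxx.
have growth l : (l <= k)%N -> a * (b l)%:R < (b l.+1)%:R.
  by move=> lk; have [//|/negP] := hl l; rewrite -ltNge.
have bound l : (l <= k.+1)%N -> a ^+ l <= (b l)%:R.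
  elim: l => [_|l ih lk]; first by rewrite expr0 ler1n.
  rewrite exprS (le_trans _ (ltW (growth l lk)))//.
  by rewrite ler_wpM2l// ih// ltnW.
have : a ^+ k.+1 < (b k.+1)%:R.
  by rewrite exprS (le_lt_trans _ (growth k _))// ler_wpM2l// bound.
by apply/negP; rewrite -leNgt (le_trans _ sa)// ler_nat count_size.
Qed.

(** A finite metric space may have quadratically many pairs of near points, yet
    far fewer links control all of them, if a link may be [k.+1] times longer.
    A point [x0] is linked to a ball around it whose enlargement by [c] has at
    most [a] times as many points; the near pairs that meet the ball are then
    treated, the ball is removed, and its points pay for the links. *)
Lemma sparse_links k c a s : 0 <= c -> 0 <= a ->
  (size s)%:R <= a ^+ k.+1 ->
  exists U : seq (T * T),
    [/\ (size U)%:R <= a * (size s)%:R,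
        forall x y, (x, y) \in U ->
          [/\ x \in s, y \in s & mdist x y <= k.+1%:R * c]
      & forall x y, x \in s -> y \in s -> mdist x y <= c ->
          exists2 z, (z, x) \in U & (z, y) \in U].
Proof.
move=> c0 a0; move: {2}(size s) (leqnn (size s)) => m.
elim: m s => [|m ih] s.
  rewrite leqn0 => /nilP -> _; exists [::].
  by split => //=; rewrite mulr0.
move=> sm sa; have [->|] := eqVneq s [::].
  by exists [::]; split => //=; rewrite mulr0.
case: s sm sa => // x0 s0 sm sa _.
move: (x0 :: s0) (mem_head x0 s0) sm sa => {s0} s x0s sm sa.
have [l lk hl] := ball_growth x0s c0 a0 sa.
pose near j := fun y => mdist x0 y <= j%:R * c.
pose s' := [seq y <- s | ~~ near l y].
have x0l : near l x0 by rewrite /near mdistxx mulr_ge0.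
have sizes : (size s = count (near l) s + size s')%N.
  by rewrite size_filter -(count_predC (near l)).
have cgt0 : (0 < count (near l) s)%N by rewrite -has_count; apply/hasP; exists x0.
have s'm : (size s' <= m)%N.
  by rewrite -ltnS (leq_trans _ sm)// sizes -addn1 addnC leq_add2r.
have s's : (size s' <= size s)%N by rewrite sizes leq_addl.
have s'a : (size s')%:R <= a ^+ k.+1 by rewrite (le_trans _ sa)// ler_nat.
have [U' [U'size U's U'near]] := ih s' s'm s'a.
exists ([seq (x0, y) | y <- s & near l.+1 y] ++ U'); split.
- rewrite size_cat size_map size_filter natrD sizes natrD mulrDr lerD//.
- move=> x y; rewrite mem_cat => /orP[/mapP[z]|/U's].
    rewrite mem_filter => /andP[nz zs] [-> ->]; split => //.
    by rewrite (le_trans nz)// ler_wpM2r// ler_nat.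
  by rewrite !mem_filter => -[/andP[_ ->] /andP[_ ->]].
- have nearU x : x \in s -> near l.+1 x ->
      (x0, x) \in [seq (x0, y) | y <- s & near l.+1 y] ++ U'.
    by move=> xs nx; rewrite mem_cat map_f// mem_filter nx.
  have nearS x y : mdist x y <= c -> near l x -> near l.+1 y.
    move=> xy nx; rewrite /near (le_trans (metric_triangle _ x _))//.
    by rewrite -natr1 mulrDl mul1r lerD.
  have nearW x : near l x -> near l.+1 x.
    by move=> nx; rewrite /near (le_trans nx)// ler_wpM2r// ler_nat.
  move=> x y xs ys xy.
  have [nx|nx] := boolP (near l x).
    by exists x0; apply: nearU => //; [exact: nearW|exact: nearS nx].
  have [ny|ny] := boolP (near l y).
    exists x0; apply: nearU => //; last exact: nearW.
    by apply: nearS ny; rewrite metric_sym.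
  have [|||z zx zy] := U'near x y; rewrite ?mem_filter ?nx ?ny//.
  by exists z; rewrite mem_cat ?zx ?zy orbT.
Qed.

End links.

(** * Nested nets and their links *)

Lemma ler_powRN {R : realType} (x y r : R) :
  0 < x -> x <= y -> 0 <= r -> y `^ (- r) <= x `^ (- r).
Proof.
move=> x0 xy r0; have y0 := lt_le_trans x0 xy.
rewrite !powRN lef_pV2 ?posrE ?powR_gt0//.
by apply: ge0_ler_powR => //; rewrite nnegrE ltW.
Qed.

Lemma powR2N_lt1 {R : realType} (r : R) : 0 < r -> 2 `^ (- r) < 1 :> R.
Proof.
move=> r0; rewrite powRN invf_lt1 ?powR_gt0//.
by have := @gt0_ltr_powR R r r0 1 2; rewrite powR1; apply;
  rewrite ?nnegrE// ltr1n.
Qed.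

Section chaining_links.
Context {R : realType} {T : metricType R}.
Implicit Types (s : seq T) (S : set T).

(** The polynomial covering bound in the form used below: explicit finite nets,
    and only at the small scales [eta <= eta0]. *)
Definition polynomial_nets S (C t eta0 : R) : Prop :=
  forall eta, 0 < eta -> eta <= eta0 -> exists s : seq T,
    [/\ [set` s] `<=` S,
        forall x, S x -> exists2 y, y \in s & mdist y x <= eta
      & (size s)%:R <= C * eta `^ (- t)].

(** Either [sparse_links] applies with growth factor about [eta `^ - eps], and
    its links stay shorter than [rho]; or [eta] is bounded below, the net has
    boundedly many points, and all pairs of near points can be taken. *)
Lemma near_links (t eps rho C : R) :
  0 < t -> 0 < eps -> 0 < rho -> 0 < C ->
  exists2 K : R, 0 < K & forall (eta : R) s,
    0 < eta -> eta <= 1 -> 5 * eta < rho -> (size s)%:R <= C * eta `^ (- t) ->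
    exists U : seq (T * T),
      [/\ (size U)%:R <= K * eta `^ (- (t + eps)),
          forall x y, (x, y) \in U ->
            [/\ x \in s, y \in s, mdist x y < rho & mdist x y <= K * eta]
        & forall x y, x \in s -> y \in s -> mdist x y <= 5 * eta ->
            exists2 z, (z, x) \in U & (z, y) \in U].
Proof.
move=> t0 eps0 rho0 C0.
(* With k.+1 >= t / eps, a net of size at most C * eta `^ (- t) satisfies the
   hypothesis of sparse_links for a = C1 * eta `^ (- eps). *)
pose k := Num.truncn (t / eps).
pose C1 := C + 1.
have C1ge1 : 1 <= C1 by rewrite lerDr ltW.
pose r0 := rho / (k.+1%:R * 5).
have r0gt0 : 0 < r0 by rewrite divr_gt0// mulr_gt0.
have C1C : 0 <= C1 * C by rewrite mulr_ge0 ?ltW// (lt_le_trans ltr01).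
have Kr0 : 0 <= C * C * r0 `^ (- t).
  by rewrite !mulr_ge0 ?powR_ge0 ?(ltW C0).
exists (C1 * C + C * C * r0 `^ (- t) + k.+1%:R * 5).
  by apply: ltr_wpDl; [exact: addr_ge0|exact: mulr_gt0].
move=> eta s eta0 eta1 eta_rho ssize.
have etaN r : 0 <= r -> 1 <= eta `^ (- r).
  by move=> r0'; rewrite -[leLHS](powRr0 eta) ger_powR ?eta0// oppr_le0.
have etatD : eta `^ (- (t + eps)) = eta `^ (- t) * eta `^ (- eps).
  by rewrite opprD powRD// (gt_eqF eta0) implybT.
have [klt|kge] := ltP (k.+1%:R * (5 * eta)) rho.
- have [|||U [Usize Us Unear]] :=
    @sparse_links _ _ k (5 * eta) (C1 * eta `^ (- eps)) s.
  + by rewrite mulr_ge0// ltW.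
  + by rewrite mulr_ge0 ?powR_ge0// (le_trans ler01).
  + rewrite (le_trans ssize)// exprMn ler_pM ?powR_ge0 ?(ltW C0)//.
      rewrite (@le_trans _ _ C1)// ?lerDl// exprS ler_peMr ?exprn_ege1//.
      exact: le_trans ler01 _.
    rewrite -powR_mulrn ?powR_ge0// -powRrM ger_powR ?eta0// mulNr lerN2.
    by rewrite mulrC -ler_pdivrMr// ltW// truncnS_gt.
  exists U; split => //.
  + rewrite (le_trans Usize)//.
    apply: (@le_trans _ _ (C1 * C * eta `^ (- (t + eps)))).
      rewrite etatD -mulrA -mulrA ler_wpM2l ?(le_trans ler01)//.
      by rewrite mulrC mulrA ler_wpM2r ?powR_ge0.
    by rewrite ler_wpM2r ?powR_ge0// -addrA lerDl addr_ge0// mulr_ge0.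
  + move=> x y /Us[-> -> xy]; split => //; first exact: le_lt_trans klt.
    rewrite (le_trans xy)// mulrA ler_wpM2r ?(ltW eta0)// lerDr.
    exact: addr_ge0.
- have r0eta : r0 <= eta.
    by rewrite /r0 ler_pdivrMr ?mulr_gt0// mulrC -mulrA.
  exists [seq xy <- allpairs pair s s | mdist xy.1 xy.2 <= 5 * eta]; split.
  + rewrite size_filter (@le_trans _ _ ((size s)%:R * (size s)%:R))//.
      by rewrite -natrM ler_nat -(size_allpairs pair s s) count_size.
    apply: (@le_trans _ _ (C * C * r0 `^ (- t) * eta `^ (- (t + eps)))).
      apply: (@le_trans _ _ ((C * eta `^ (- t)) * (C * r0 `^ (- t)))).
        rewrite ler_pM// (le_trans ssize)// ler_wpM2l ?(ltW C0)//.
        by apply: ler_powRN => //; exact: ltW.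
      rewrite mulrACA -!mulrA !ler_wpM2l ?(ltW C0)// mulrC.
      rewrite ler_wpM2l ?powR_ge0// etatD ler_peMr ?powR_ge0//.
      by rewrite etaN// ltW.
    by rewrite ler_wpM2r ?powR_ge0// addrAC lerDr addr_ge0// mulr_ge0.
  + move=> x y; rewrite mem_filter/= => /andP[xy].
    case/allpairsP => -[a b]/= [xs ys [xa yb]]; rewrite {}xa {}yb in xy *.
    split => //; first by rewrite (le_lt_trans xy).
    rewrite (le_trans xy)// ler_wpM2r ?(ltW eta0)//.
    by apply: ler_wpDl; [exact: addr_ge0|rewrite ler_peMl// ler1n].
  + move=> x y xs ys xy; exists x; rewrite mem_filter/=.
      by rewrite mdistxx mulr_ge0 ?(ltW eta0)//=; exact: allpairs_f.
    by rewrite xy; exact: allpairs_f.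
Qed.

(** Adding the point [e k] to the net of scale [k] before taking unions costs
    one point per scale, and puts any prescribed sequence of points of [S] in
    the union of the nets. The sizes are those of a geometric sum. *)
Lemma nested_nets (S : set T) (e : nat -> T) (t C eta0 : R) :
  0 < t -> 0 < C -> 0 < eta0 -> eta0 <= 1 ->
  polynomial_nets S C t eta0 ->
  exists2 K : R, 0 < K & exists A : nat -> seq T, forall k,
    [/\ [set` A k] `<=` S, {subset A k <= A k.+1}, S (e k) -> e k \in A k,
        forall x, S x -> exists2 y, y \in A k & mdist y x <= eta0 / 2 ^+ k
      & (size (A k))%:R <= K * (eta0 / 2 ^+ k) `^ (- t)].
Proof.
move=> t0 C0 eta00 eta01 nets.
have eta_gt0 k : 0 < eta0 / 2 ^+ k :> R by rewrite divr_gt0// exprn_gt0.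
have eta_le k : eta0 / 2 ^+ k <= eta0.
  by rewrite ler_pdivrMr ?exprn_gt0// ler_peMr ?(ltW eta00)// exprn_ege1// ler1n.
have /choice[N HN] : forall k, exists s : seq T,
    [/\ [set` s] `<=` S,
        forall x, S x -> exists2 y, y \in s & mdist y x <= eta0 / 2 ^+ k
      & (size s)%:R <= C * (eta0 / 2 ^+ k) `^ (- t)].
  by move=> k; exact: nets.
pose add k := if `[< S (e k) >] then e k :: N k else N k.
pose A k := flatten (mkseq add k.+1).
have AS k : A k.+1 = A k ++ add k.+1.
  by rewrite /A mkseqS flatten_rcons.
have A0 : A 0%N = add 0%N by rewrite /A /mkseq/= cats0.
have addA k : {subset add k <= A k}.
  by case: k => [|k] x; rewrite ?A0// AS mem_cat => ->; rewrite orbT.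
have Nadd k : {subset N k <= add k}.
  by move=> x xN; rewrite /add; case: ifP; rewrite // in_cons xN orbT.
have addS k x : x \in add k -> S x.
  have [NS _ _] := HN k; rewrite /add; case: ifPn => [/asboolP Se|_].
    by rewrite in_cons => /predU1P[->//|/NS].
  by move/NS.
have addsize k : (size (add k))%:R <= (C + 1) * (eta0 / 2 ^+ k) `^ (- t).
  have [_ _ Ns] := HN k.
  rewrite (@le_trans _ _ ((size (N k)).+1)%:R)//.
    by rewrite ler_nat /add; case: ifP.
  rewrite -natr1 mulrDl lerD// mul1r -[leLHS](powRr0 (eta0 / 2 ^+ k)).
  by rewrite ger_powR ?eta_gt0 ?oppr_le0 ?(ltW t0)// (le_trans (eta_le _)).
have two_t : 2 `^ (- t) < 1 :> R by exact: powR2N_lt1.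
(* K solves K * 2 `^ (- t) + (C + 1) = K, the recursion of the sizes. *)
pose K := (C + 1) / (1 - 2 `^ (- t)).
have K_ge : C + 1 <= K.
  rewrite /K ler_peMr ?addr_ge0 ?(ltW C0)// invf_ge1 ?subr_gt0//.
exists K; first by rewrite (lt_le_trans _ K_ge)// addr_gt0.
exists A => k; split.
- elim: k => [|k ih] x /=; first by rewrite A0; exact: addS.
  by rewrite AS mem_cat => /orP[|]; [exact: ih|exact: addS].
- by move=> x xA; rewrite AS mem_cat xA.
- by move=> Sek; apply: addA; rewrite /add asboolT// mem_head.
- move=> x Sx; have [_ /(_ x Sx)[y yN yx] _] := HN k.
  by exists y => //; exact/addA/Nadd.
- elim: k => [|k ih].
    by rewrite A0 (le_trans (addsize _))// ler_wpM2r// powR_ge0.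
  rewrite AS size_cat natrD (le_trans (lerD ih (addsize _)))//.
  have -> : eta0 / 2 ^+ k = 2 * (eta0 / 2 ^+ k.+1).
    by rewrite exprS invfM mulrCA mulVKf.
  rewrite powRM ?(ltW (eta_gt0 _))// mulrA -mulrDl ler_wpM2r ?powR_ge0//.
  have -> : C + 1 = K * (1 - 2 `^ (- t)) by rewrite /K divfK// subr_eq0 gt_eqF.
  by rewrite -mulrDr subrKC mulr1.
Qed.

(** The family [L k] consists of the links of [near_links] between near points
    of [A k] and of one link from each point of [A k.+1] to a close point of
    [A k]. Up to constants, the bound on its size is that for
    [A k] times [eta `^ - eps]. *)
Lemma chaining_links (S : set T) (e : nat -> T) (t C eta0 eps rho : R) :
  0 < t -> 0 < C -> 0 < eta0 -> eta0 <= 1 -> 0 < eps -> 5 * eta0 < rho ->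
  polynomial_nets S C t eta0 ->
  exists2 K : R, 0 < K & exists (A : nat -> seq T) (L : nat -> seq (T * T)),
    forall k, let eta := eta0 / 2 ^+ k in
    [/\ [/\ {subset A k <= A k.+1}, S (e k) -> e k \in A k
          & (size (L k))%:R <= K * eta `^ (- (t + eps))],
        forall x y, (x, y) \in L k ->
          [/\ S x, S y, mdist x y < rho & mdist x y <= K * eta],
        forall x, x \in A k.+1 ->
          exists2 y, y \in A k & mdist y x <= eta /\ (y, x) \in L k
      & forall x y, x \in A k -> y \in A k -> mdist x y <= 5 * eta ->
          exists2 z, (z, x) \in L k & (z, y) \in L k].
Proof.
move=> t0 C0 eta00 eta01 eps0 eta0rho nets.
have eta_gt0 k : 0 < eta0 / 2 ^+ k :> R by rewrite divr_gt0// exprn_gt0.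
have eta_le k : eta0 / 2 ^+ k <= eta0.
  by rewrite ler_pdivrMr ?exprn_gt0// ler_peMr ?(ltW eta00)// exprn_ege1// ler1n.
have rho0 : 0 < rho by rewrite (le_lt_trans _ eta0rho)// mulr_ge0// ltW.
have [K1 K10 [A HA]] := nested_nets e t0 C0 eta00 eta01 nets.
have [K2 K20 near] := near_links t0 eps0 rho0 K10.
have /choice[U HU] : forall k, exists U : seq (T * T),
      [/\ (size U)%:R <= K2 * (eta0 / 2 ^+ k) `^ (- (t + eps)),
          forall x y, (x, y) \in U ->
            [/\ x \in A k, y \in A k, mdist x y < rho & mdist x y <= K2 * (eta0 / 2 ^+ k)]
        & forall x y, x \in A k -> y \in A k -> mdist x y <= 5 * (eta0 / 2 ^+ k) ->
            exists2 z, (z, x) \in U & (z, y) \in U].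
  move=> k; have [_ _ _ _ As] := HA k; apply: near => //.
    exact: le_trans (eta_le _) _.
  by rewrite (le_lt_trans _ eta0rho)// ler_wpM2l.
have /choice[par Hpar] : forall kx : nat * T, exists y, S kx.2 ->
    y \in A kx.1 /\ mdist y kx.2 <= eta0 / 2 ^+ kx.1.
  move=> [k x]/=; have [Sx|nSx] := pselect (S x); last by exists x.
  by have [_ _ _ /(_ x Sx)[y yA yx] _] := HA k; exists y.
exists (K1 * 2 `^ t + K2 + 1).
  by rewrite ltr_wpDl// addr_ge0 ?mulr_ge0 ?powR_ge0// ltW.
exists A, (fun k => U k ++ [seq (par (k, x), x) | x <- A k.+1]) => k eta.
have eta_gt : 0 < eta := eta_gt0 k.
have [AkS Ainc Ae Acov Asize] := HA k.
have [ASS _ _ _ ASsize] := HA k.+1.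
have [Usize UA Unear] := HU k.
split.
- split => //; rewrite size_cat size_map natrD.
  apply: (@le_trans _ _ ((K2 + K1 * 2 `^ t) * eta `^ (- (t + eps)))).
    rewrite mulrDl lerD// (le_trans ASsize)// -mulrA ler_wpM2l ?(ltW K10)//.
    have -> : eta0 / 2 ^+ k.+1 = 2^-1 * eta.
      by rewrite exprS invfM mulrCA mulrA.
    rewrite powRM ?invr_ge0 ?(ltW eta_gt)//.
    have -> : 2^-1 `^ (- t) = 2 `^ t :> R.
      by rewrite -powR_inv1// -powRrM mulN1r opprK.
    rewrite ler_wpM2l ?powR_ge0// ger_powR ?eta_gt ?(le_trans (eta_le _))//.
    by rewrite lerN2 lerDl ltW.
  by rewrite ler_wpM2r ?powR_ge0// (addrC K2) lerDl.
- move=> x y; rewrite mem_cat => /orP[/UA[/AkS Sx /AkS Sy xyr xyK]|].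
    split => //; rewrite (le_trans xyK)// ler_wpM2r ?(ltW eta_gt)//.
    by rewrite addrAC lerDr addr_ge0// mulr_ge0 ?powR_ge0 ?ltW.
  case/mapP => z /ASS Sz [-> ->]; have [/= pA pd] := Hpar (k, z) Sz.
  split => //; first exact: AkS.
    rewrite (le_lt_trans pd)// (le_lt_trans (eta_le _))//.
    by rewrite (le_lt_trans _ eta0rho)// ler_peMl ?(ltW eta00)// ler1n.
  rewrite (le_trans pd)// ler_peMl ?(ltW eta_gt)// lerDr.
  by rewrite addr_ge0 ?mulr_ge0 ?powR_ge0 ?ltW.
- move=> x xA; have [/= pA pd] := Hpar (k, x) (ASS _ xA).
  exists (par (k, x)) => //; split => //.
  by rewrite mem_cat (map_f (fun x => (par (k, x), x)) xA) orbT.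
- move=> x y xA yA /(Unear _ _ xA yA)[z zx zy].
  by exists z; rewrite mem_cat ?zx ?zy.
Qed.

End chaining_links.

(** * Chaining *)

(** Two points at distance about [eta0 / 2 ^+ k] descend, scale by scale, to
    points of [A k] that are within five times that scale of each other, hence
    joined by two links of [L k]; the increments along the way form a geometric
    series. *)
Lemma chaining_bound {R : realType} {T X : metricType R} (beta eta0 : R) :
  0 < beta -> 0 < eta0 ->
  exists2 K : R, 0 < K & forall (A : nat -> seq T) (L : nat -> seq (T * T)),
    (forall k, let eta := eta0 / 2 ^+ k in
      [/\ {subset A k <= A k.+1},
          forall x, x \in A k.+1 ->
            exists2 y, y \in A k & mdist y x <= eta /\ (y, x) \in L k
        & forall x y, x \in A k -> y \in A k -> mdist x y <= 5 * eta ->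
            exists2 z, (z, x) \in L k & (z, y) \in L k]) ->
    forall (f : T -> X) (w : R), 0 <= w ->
    (forall k x y, (x, y) \in L k ->
       mdist (f x) (f y) <= w * (eta0 / 2 ^+ k) `^ beta) ->
    forall x y i j, x \in A i -> y \in A j -> mdist x y <= eta0 ->
      mdist (f x) (f y) <= K * w * mdist x y `^ beta.
Proof.
move=> beta0 eta00.
have eta_gt0 k : 0 < eta0 / 2 ^+ k :> R by rewrite divr_gt0// exprn_gt0.
have etaS k : eta0 / 2 ^+ k = 2 * (eta0 / 2 ^+ k.+1).
  by rewrite exprS invfM mulrCA mulVKf.
have h1 : 2 `^ (- beta) < 1 :> R by exact: powR2N_lt1.
(* The sum of the powers of 2 `^ (- beta): descending through all the scales
   costs c times the increment allowed at the coarsest one. *)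
pose c : R := (1 - 2 `^ (- beta))^-1.
have c0 : 0 < c by rewrite invr_gt0 subr_gt0.
exists ((c + 2 + c) * 2 `^ beta).
  by rewrite mulr_gt0 ?powR_gt0// !addr_gt0.
move=> A L AL f w w0 fL.
have Amono i n : {subset A i <= A (n + i)%N}.
  elim: n => [//|n ih] x xi; have [AS _ _] := AL (n + i)%N.
  by rewrite addSn; exact/AS/ih.
have chain n k x : x \in A (n + k)%N -> exists2 y, y \in A k &
    mdist y x <= 2 * (eta0 / 2 ^+ k) /\
    mdist (f y) (f x) <= w * (c * (eta0 / 2 ^+ k) `^ beta).
  elim: n k => [|n ih] k xA.
    exists x => //; rewrite !mdistxx; split; first by rewrite mulr_ge0// ltW.
    by rewrite !mulr_ge0 ?powR_ge0 ?(ltW c0).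
  rewrite addSnnS in xA; have [y yA [yx fyx]] := ih _ xA.
  have [_ /(_ y yA)[z zA [zy zyL]] _] := AL k.
  exists z => //; split.
    rewrite (le_trans (metric_triangle _ y _))// mulr2n mulrDl mul1r lerD//.
    by rewrite etaS.
  rewrite (le_trans (metric_triangle _ (f y) _))//.
  rewrite (le_trans (lerD (fL _ _ _ zyL) fyx))// -mulrDr ler_wpM2l//.
  have -> : eta0 / 2 ^+ k.+1 = 2^-1 * (eta0 / 2 ^+ k).
    by rewrite [in RHS]etaS mulKf.
  rewrite (@powRM _ 2^-1) ?invr_ge0 ?(ltW (eta_gt0 _))// mulrA -[X in X + _]mul1r -mulrDl.
  rewrite ler_wpM2r ?powR_ge0//.
  have -> : 2^-1 `^ beta = 2 `^ (- beta) :> R.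
    by rewrite -powR_inv1// -powRrM mulN1r.
  have {1}-> : 1 = c * (1 - 2 `^ (- beta)).
    by rewrite mulVf// subr_eq0 gt_eqF.
  by rewrite -mulrDr subrK mulr1.
move=> x y i j xi yj xy.
have [<-|xney] := eqVneq x y.
  by rewrite !mdistxx mulr_ge0 ?powR_ge0// !mulr_ge0 ?powR_ge0// !addr_ge0// ltW.
have d0 : 0 < mdist x y by rewrite mdist_gt0.
have ex : exists k, eta0 / 2 ^+ k.+1 < mdist x y.
  have [k hk] : exists k : nat, eta0 / mdist x y < k%:R.
    by exists (Num.truncn (eta0 / mdist x y)).+1; exact: truncnS_gt.
  exists k; rewrite ltr_pdivrMr ?exprn_gt0// mulrC -ltr_pdivrMr//.
  rewrite (lt_trans hk)// -natrX ltr_nat.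
  by rewrite (ltn_trans (ltnSn k))// ltn_expl.
have [k hk kmin] := find_ex_minn ex.
have xyk : mdist x y <= eta0 / 2 ^+ k.
  case: k hk kmin => [|k] hk kmin; first by rewrite expr0 divr1.
  by rewrite leNgt; apply/negP => /kmin; rewrite ltnn.
have xA : x \in A (j + i + k)%N by rewrite addnAC; exact: Amono.
have yA : y \in A (j + i + k)%N by rewrite -addnA addnC; exact: Amono.
have [x' x'A [x'x fx]] := chain _ _ _ xA.
have [y' y'A [y'y fy]] := chain _ _ _ yA.
have [_ _ near] := AL k.
have [|z zx zy] := near _ _ x'A y'A.
  rewrite (le_trans (metric_triangle _ x _))//.
  rewrite (le_trans (lerD x'x (metric_triangle _ y _)))//.
  rewrite (metric_sym y) (le_trans (lerD (lexx _) (lerD xyk y'y)))//.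
  by rewrite -[X in _ + (X + _)]mul1r -!mulrDl -[X in _ + (X + _)]/(1%:R) -!natrD.
rewrite (le_trans (metric_triangle _ (f x') _))//.
rewrite (le_trans (lerD (lexx _) (metric_triangle _ (f y') _)))//.
rewrite (metric_sym (f x)).
rewrite (le_trans (lerD fx (lerD (metric_triangle _ (f z) _) fy)))//.
rewrite (metric_sym (f x')).
rewrite (le_trans (lerD (lexx _) (lerD (lerD (fL _ _ _ zx) (fL _ _ _ zy)) (lexx _))))//.
set E := (eta0 / 2 ^+ k) `^ beta.
apply: (@le_trans _ _ ((c + 2 + c) * (w * E))).
  by rewrite !mulrDl !mul1r (mulrCA c) !addrA.
rewrite -2!mulrA ler_wpM2l ?addr_ge0 ?(ltW c0)// mulrCA ler_wpM2l//.
rewrite -powRM ?mdist_ge0// ge0_ler_powR ?nnegrE ?(ltW beta0)//.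
- exact: ltW.
- by rewrite mulr_ge0// mdist_ge0.
- by rewrite etaS ler_wpM2l// ltW.
Qed.

(** * Borel measurability in metric spaces *)

Section borel_measurable.
Context {d : measure_display} {Omega : measurableType d}.

Lemma borel_measurableP {T : topologicalType} (f : Omega -> T) :
  (forall O, open O -> measurable (f @^-1` O)) -> borel_measurable f.
Proof.
move=> fO; suff: <<s @open T >> `<=` [set B | measurable (f @^-1` B)] by [].
apply: smallest_sub; last exact: fO.
split => [|A mA|A mA] /=.
- by rewrite preimage_set0.
- by rewrite setTD -preimage_setC; exact: measurableC.
- by rewrite preimage_bigcup; by apply: bigcup_measurable => k _; exact: mA.
Qed.

Lemma borel_measurable_open {T : topologicalType} (f : Omega -> T) O :
  borel_measurable f -> open O -> measurable (f @^-1` O).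
Proof. by move=> mf oO; apply: mf; exact: sub_sigma_algebra. Qed.

Lemma borel_measurable_closed {T : topologicalType} (f : Omega -> T) D :
  borel_measurable f -> closed D -> measurable (f @^-1` D).
Proof.
move=> mf cD; rewrite -[D]setCK preimage_setC; apply: measurableC.
exact: (borel_measurable_open mf (closed_openC cD)).
Qed.

Lemma borel_measurable_comp {T U : topologicalType} (f : Omega -> T)
  (g : T -> U) : borel_measurable f -> continuous g -> borel_measurable (g \o f).
Proof.
move=> mf /continuousP cg; apply: borel_measurableP => O oO.
by rewrite comp_preimage; exact: (borel_measurable_open mf (cg _ oO)).
Qed.

Lemma borel_measurable_if {T : topologicalType} (D : set Omega)
    (f g : Omega -> T) :
  measurable D -> borel_measurable f -> borel_measurable g ->
  borel_measurable (fun w => if `[< D w >] then f w else g w).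
Proof.
move=> mD mf mg; apply: borel_measurableP => O oO.
rewrite [X in measurable X](_ : _ =
    (D `&` f @^-1` O) `|` (~` D `&` g @^-1` O)); last first.
  apply/seteqP; split => w /=.
    by case: asboolP => [Dw fw|Dw gw]; [left|right].
  by case: asboolP => [Dw [[]//|[]//]|Dw [[]//|[]//]].
apply: measurableU; apply: measurableI => //.
- exact: borel_measurable_open mf oO.
- exact: measurableC.
- exact: borel_measurable_open mg oO.
Qed.

(** The preimage of an open set [O] is expressed through the closures of the
    sets of points whose ball of radius [m.+1%:R^-1] lies in [O]: they lie in
    [O], and a sequence with a limit in [O] is eventually in one of them. *)
Lemma borel_measurable_lim {R : realType} {T : pseudoMetricType R}
    (f : nat -> Omega -> T) (g : Omega -> T) :
  (forall k, borel_measurable (f k)) ->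
  (forall w, f k w @[k --> \oo] --> g w) -> borel_measurable g.
Proof.
move=> mf fg; apply: borel_measurableP => O oO.
pose r m : R := m.+1%:R^-1.
have r0 m : 0 < r m by rewrite invr_gt0.
pose D m := closure [set x | ball x (r m) `<=` O].
have -> : g @^-1` O =
    \bigcup_m \bigcup_N \bigcap_(k in [set k | (N <= k)%N]) f k @^-1` D m.
  apply/seteqP; split => [w /= Ogw|w [m _ [N _ fD]] /=].
    have /nbhs_ballP[e /= e0 gO] : nbhs (g w) O by exact: open_nbhs_nbhs.
    have [m me] : exists m, r m < e / 2.
      exists (Num.truncn (e / 2)^-1); rewrite /r invf_plt ?posrE ?divr_gt0//.
      exact: truncnS_gt.
    have e20 : 0 < e / 2 by rewrite divr_gt0.
    have /cvg_ballP/(_ _ e20)[N _ fN] := fg w.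
    exists m => //; exists N => // k /= Nk; apply: subset_closure => y /= fy.
    apply: gO; rewrite [e]splitr; apply: ball_triangle (fN k Nk) _.
    exact: le_ball (ltW me) _ fy.
  have : D m (g w).
    apply: (closed_cvg (D m) (@closed_closure _ _) _ _ (fg w)).
    by exists N => // k /= Nk; exact: fD.
  move=> /(_ _ (nbhsx_ballx _ _ (r0 m)))[y [yO gy]].
  exact/yO/ball_sym.
apply: bigcup_measurable => m _; apply: bigcup_measurable => N _.
apply: bigcap_measurableType => k _.
exact: (borel_measurable_closed (mf k) (@closed_closure _ _)).
Qed.

End borel_measurable.

Section metric_measurability.
Context {R : realType} {d : measure_display} {Omega : measurableType d}.
Context {X : metricType R}.

Lemma mdist_lipschitz (a b a' b' : X) :
  `|mdist a b - mdist a' b'| <= mdist a a' + mdist b b'.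
Proof.
have tri (x y x' y' : X) : mdist x y - mdist x' y' <= mdist x x' + mdist y y'.
  rewrite lerBlDr (le_trans (metric_triangle _ x' _))// -addrA lerD2l.
  by rewrite addrC (metric_sym y) metric_triangle.
by rewrite ler_norml tri andbT lerNl opprB (metric_sym a a') (metric_sym b b') tri.
Qed.

Lemma continuous_mdist : continuous (fun z : X * X => mdist z.1 z.2 : R).
Proof.
move=> [a b]; apply/cvgrPdist_lt => e e0.
have e20 : 0 < e / 2 by rewrite divr_gt0.
exists (ball a (e / 2), ball b (e / 2)).
  by split; exact: nbhsx_ballx.
move=> [a' b'] /= []; rewrite !ballEmdist/= => aa' bb'.
by rewrite (le_lt_trans (mdist_lipschitz _ _ _ _))// [e]splitr ltrD.
Qed.

Lemma measurable_mdist (f g : Omega -> X) :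
  borel_measurable (fun w => (f w, g w)) ->
  measurable_fun [set: Omega] (fun w => mdist (f w) (g w) : R).
Proof.
move=> /borel_measurable_comp/(_ continuous_mdist) mfg.
move=> mD; apply: (measurability _ (RGenOpens.measurableE R)) => //.
move=> _ [_ [a [b ->] <-]]; rewrite setTI.
by apply: (borel_measurable_open mfg); exact: interval_open.
Qed.

Lemma measurable_eq_set (f g : Omega -> X) :
  borel_measurable (fun w => (f w, g w)) -> measurable [set w | f w = g w].
Proof.
move=> /measurable_mdist mfg.
rewrite [X in measurable X](_ : _ =
    (fun w => mdist (f w) (g w)) @^-1` [set 0 : R]).
  by rewrite -[X in measurable X]setTI; exact: mfg.
apply/seteqP; split => w /=; first by move=> ->; rewrite mdistxx.
exact: mdist_positivity.
Qed.

Lemma cvg_mdist (f g : nat -> X) (x y : X) :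
  f @ \oo --> x -> g @ \oo --> y ->
  (fun k => mdist (f k) (g k) : R) @ \oo --> (mdist x y : R).
Proof.
move=> /cvg_ballP fx /cvg_ballP gy; apply/cvgrPdist_lt => e e0.
have e20 : 0 < e / 2 by rewrite divr_gt0.
near=> k; rewrite (le_lt_trans (mdist_lipschitz _ _ _ _))// [e]splitr.
rewrite ltrD//.
- have : ball x (e / 2) (f k) by near: k; exact: fx.
  by rewrite ballEmdist.
- have : ball y (e / 2) (g k) by near: k; exact: gy.
  by rewrite ballEmdist.
Unshelve. all: by end_near. Qed.

Lemma borel_measurable_diag (f : Omega -> X) :
  borel_measurable f -> borel_measurable (fun w => (f w, f w)).
Proof.
move=> mf; apply: (@borel_measurable_comp _ _ _ _ f (fun x => (x, x)) mf).
by move=> x; apply: cvg_pair; exact: cvg_id.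
Qed.

Lemma borel_measurable_cst_pair (x0 : X) (f : Omega -> X) :
  borel_measurable f -> borel_measurable (fun w => (x0, f w)).
Proof.
move=> mf; apply: (@borel_measurable_comp _ _ _ _ f (fun x => (x0, x)) mf).
by move=> x; apply: cvg_pair; [exact: cvg_cst|exact: cvg_id].
Qed.

End metric_measurability.

(** * An integrable majorant of the Hölder quotients *)

Lemma nneseries_le {R : realType} (u : nat -> \bar R) (B : \bar R) :
  (forall k, (0 <= u k)%E) -> (forall n, (\sum_(0 <= k < n) u k <= B)%E) ->
  (\sum_(k <oo) u k <= B)%E.
Proof.
move=> u0 uB; apply: lime_le; first by apply: is_cvg_nneseries.
exact: nearW.
Qed.

Lemma le_sum_seq {R : realType} {I : eqType} (s : seq I) (f : I -> R) x :
  (forall y, 0 <= f y) -> x \in s -> f x <= \sum_(y <- s) f y.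
Proof.
by move=> f0 xs; rewrite (big_rem x)//= lerDl sumr_ge0.
Qed.

(** A single [W] serves all pairs of indices, so that this is an assertion about
    paths. The value [+oo] is allowed for [W], necessarily on a null set, and
    entails no bound there. *)
Definition hoelder_majorant {R : realType} {T X : metricType R}
    {d : measure_display} {Omega : measurableType d} (P : probability Omega R)
    (Z : T -> Omega -> X) (e : nat -> T) (S : set T) (delta beta p : R)
    (W : Omega -> \bar R) : Prop :=
  [/\ measurable_fun [set: Omega] W, forall w, (0 <= W w)%E,
      (\int[P]_w W w < +oo)%E
    & forall w i j, (W w < +oo)%E -> S (e i) -> S (e j) ->
        mdist (e i) (e j) <= delta ->
        mdist (Z (e i) w) (Z (e j) w) `^ p <=
          fine (W w) * mdist (e i) (e j) `^ (beta * p)].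

Section hoelder_moment.
Context {R : realType} {T X : metricType R}.
Context {d : measure_display} {Omega : measurableType d}.
Variables (P : probability Omega R) (Z : T -> Omega -> X).
Variables (S : set T) (t C eta0 rho M p q : R).
Hypotheses (t0 : 0 < t) (C0 : 0 < C) (eta00 : 0 < eta0) (eta01 : eta0 <= 1).
Hypotheses (eta0rho : 5 * eta0 < rho) (M0 : 0 < M) (p0 : 0 < p) (tq : t < q).
Hypothesis nets : polynomial_nets S C t eta0.
Hypothesis mZ : forall x y,
  measurable_fun [set: Omega] (fun w => mdist (Z x w) (Z y w) : R).
Hypothesis moment : forall x y, S x -> S y -> mdist x y < rho ->
  (\int[P]_w (mdist (Z x w) (Z y w) `^ p)%:E <= (M * mdist x y `^ q)%:E)%E.

(** The majorant is the weighted sum of the [p]-th powers of the increments of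
    [Z] over all links. It bounds every
    single increment, so that chaining applies pointwise, and it is integrable
    because the links at scale [eta] contribute at most a constant times
    [eta `^ (- (t + eps)) * eta `^ q * eta `^ (- (beta * p))], where the
    exponents add up to [eps]. *)
Lemma hoelder_moment (e : nat -> T) (beta : R) :
  0 < beta -> beta < (q - t) / p ->
  exists W, hoelder_majorant P Z e S eta0 beta p W.
Proof.
move=> beta0; rewrite ltr_pdivlMr// => betaq.
(* Half of the gap is spent on the number of links, the other half makes the
   sum over the scales converge. *)
pose eps := (q - t - beta * p) / 2.
have eps0 : 0 < eps by rewrite divr_gt0// subr_gt0.
have [K K0 [A [L HAL]]] := chaining_links e t0 C0 eta00 eta01 eps0 eta0rho nets.
have [K' K'0 chain] := @chaining_bound R T X beta eta0 beta0 eta00.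
pose eta k : R := eta0 / 2 ^+ k.
have eta_gt0 k : 0 < eta k by rewrite /eta divr_gt0// exprn_gt0.
(* The factor c absorbs the constant of the chaining bound. *)
pose c := K' `^ p.
have c0 : 0 < c by rewrite powR_gt0.
pose g k (xy : T * T) w : R :=
  c * eta k `^ (- (beta * p)) * mdist (Z xy.1 w) (Z xy.2 w) `^ p.
have g0 k xy w : 0 <= g k xy w.
  by rewrite !mulr_ge0 ?powR_ge0// ltW.
pose G k w : \bar R := (\sum_(xy <- L k) (g k xy w)%:E)%E.
have G0 k w : (0 <= G k w)%E by rewrite sume_ge0// => xy _; rewrite lee_fin.
have mg k xy : measurable_fun [set: Omega] (fun w => (g k xy w)%:E).
  apply/measurable_EFinP/measurable_funM => //.
  exact: (measurableT_comp (measurable_powR p) (mZ xy.1 xy.2)).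
have mG k : measurable_fun [set: Omega] (G k) by exact: emeasurable_sum.
pose W w : \bar R := (\sum_(k <oo) G k w)%E.
have W0 w : (0 <= W w)%E by exact: nneseries_ge0.
exists W; split => //.
- apply: (eq_measurable_fun (fun w => \sum_(k <oo | k \in predT) G k w)%E) => //.
  exact: ge0_emeasurable_sum.
- rewrite integral_nneseries//.
  pose b := c * K * (M * K `^ q).
  have b0 : 0 <= b by rewrite !mulr_ge0 ?powR_ge0 ?ltW.
  have intG k : (\int[P]_w G k w <= (b * eta k `^ eps)%:E)%E.
    have [[_ _ Lsize] LS _ _] := HAL k.
    rewrite ge0_integral_sum//; last by move=> xy w _; rewrite lee_fin.
    have bound xy : xy \in L k -> (\int[P]_w (g k xy w)%:E <=
        (c * eta k `^ (- (beta * p)) * (M * (K * eta k) `^ q))%:E)%E.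
      case: xy => x y /LS[Sx Sy xyrho xyK].
      under eq_integral do rewrite /g/= EFinM.
      rewrite ge0_integralZl_EFin//.
      + rewrite [leRHS]EFinM lee_pmul2l// ?lte_fin ?mulr_gt0 ?powR_gt0//.
        rewrite (le_trans (moment Sx Sy xyrho))// lee_fin ler_wpM2l ?(ltW M0)//.
        rewrite ge0_ler_powR ?nnegrE ?mdist_ge0// ?(ltW (lt_trans t0 tq))//.
        by rewrite mulr_ge0// ltW.
      + by move=> w _; rewrite lee_fin powR_ge0.
      + apply/measurable_EFinP.
        exact: (measurableT_comp (measurable_powR p) (mZ x y)).
      + by rewrite mulr_ge0 ?powR_ge0// ltW.
    rewrite big_seq (le_trans (lee_sum _ bound))// -big_seq.
    rewrite sumEFin lee_fin big_const_seq count_predT iter_addr_0 -mulr_natr.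
    set D := _ * (M * _); have D0 : 0 <= D.
      by rewrite !mulr_ge0 ?powR_ge0// ltW.
    rewrite (le_trans (ler_wpM2l D0 Lsize))// le_eqVlt; apply/orP; left.
    apply/eqP; rewrite /D powRM ?(ltW K0) ?(ltW (eta_gt0 _))//.
    rewrite -/(eta k).
    have -> : eta k `^ eps =
        eta k `^ (- (beta * p)) * eta k `^ q * eta k `^ (- (t + eps)).
      rewrite -!powRD ?(gt_eqF (eta_gt0 _)) ?implybT//; congr (_ `^ _).
      have : q - t - beta * p = eps + eps by rewrite /eps -splitr.
      lra.
    by rewrite /b; ring.
  pose h : R := 2^-1 `^ eps.
  have h1 : h < 1.
    have := @gt0_ltr_powR R eps eps0 2^-1 1; rewrite powR1; apply;
      rewrite ?nnegrE//.
    by rewrite invf_lt1// ltr1n.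
  have h0 : 0 < h by rewrite powR_gt0.
  have etaE k : b * eta k `^ eps = geometric (b * eta0 `^ eps) h k.
    rewrite /= /eta powRM ?(ltW eta00)// -exprVn -powR_mulrn//.
    by rewrite powRAC powR_mulrn ?(ltW h0)// mulrA.
  have bge0 : 0 <= b * eta0 `^ eps by rewrite mulr_ge0// powR_ge0.
  apply: (@le_lt_trans _ _ (b * eta0 `^ eps * (1 - h)^-1)%:E); last exact: ltry.
  apply: nneseries_le => [k|n]; first exact: integral_ge0.
  apply: (@le_trans _ _ (\sum_(0 <= k < n) (geometric (b * eta0 `^ eps) h k)%:E)%E).
    by apply: lee_sum => k _; rewrite -etaE.
  rewrite sumEFin lee_fin; apply: geometric_le_lim => //.
  by rewrite gtr0_norm.
- move=> w i j Wfin Si Sj ij.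
  have WE : W w = (fine (W w))%:E by rewrite fineK// ge0_fin_numE.
  have fW0 : 0 <= fine (W w) by rewrite fine_ge0.
  pose v := (fine (W w) / c) `^ p^-1.
  have fLe k x y : (x, y) \in L k ->
      mdist (Z x w) (Z y w) <= v * (eta k) `^ beta.
    move=> xyL.
    have gW : g k (x, y) w <= fine (W w).
      rewrite -lee_fin -WE.
      apply: (@le_trans _ _ (\sum_(0 <= k < k.+1) G k w)%E); last first.
        exact: nneseries_lim_ge.
      rewrite big_nat_recr//= (@le_trans _ _ (G k w))//; last first.
        by rewrite leeDr// sume_ge0.
      rewrite /G sumEFin lee_fin.
      exact: (@le_sum_seq _ _ (L k) (fun xy => g k xy w)).
    have -> : mdist (Z x w) (Z y w) = (mdist (Z x w) (Z y w) `^ p) `^ p^-1.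
      by rewrite -powRrM divff ?gt_eqF// powRr1// mdist_ge0.
    have -> : v * eta k `^ beta = (fine (W w) / c * eta k `^ (beta * p)) `^ p^-1.
      rewrite powRM ?powR_ge0 ?divr_ge0 ?(ltW c0)//.
      by rewrite -[in RHS]powRrM mulfK ?gt_eqF.
    rewrite ge0_ler_powR ?nnegrE ?powR_ge0 ?invr_ge0 ?(ltW p0)//.
      by rewrite mulr_ge0 ?powR_ge0 ?divr_ge0 ?(ltW c0).
    rewrite mulrAC ler_pdivlMr// mulrC -ler_pdivrMr ?powR_gt0//.
    by move: gW; rewrite /g/= powRN mulrAC.
  have v0 : 0 <= v by rewrite powR_ge0.
  have AL k : let eta := eta0 / 2 ^+ k in
      [/\ {subset A k <= A k.+1},
          forall x, x \in A k.+1 ->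
            exists2 y, y \in A k & mdist y x <= eta /\ (y, x) \in L k
        & forall x y, x \in A k -> y \in A k -> mdist x y <= 5 * eta ->
            exists2 z, (z, x) \in L k & (z, y) \in L k].
    by have [[]] := HAL k.
  have eA k : S (e k) -> e k \in A k by have [[]] := HAL k.
  have := chain A L AL (fun x => Z x w) v v0 fLe _ _ _ _ (eA _ Si) (eA _ Sj) ij.
  move=> /(ge0_ler_powR (ltW p0) (mdist_ge0 _ _)) => /(_ _).
  rewrite nnegrE !mulr_ge0 ?powR_ge0 ?(ltW K'0)// => /(_ isT)/le_trans; apply.
  rewrite powRM ?powR_ge0 ?mulr_ge0 ?(ltW K'0)// powRM ?(ltW K'0)//.
  rewrite -!powRrM mulVf ?gt_eqF// powRr1 ?divr_ge0 ?(ltW c0)//.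
  by rewrite -/c mulrC (mulrC c) divfK ?gt_eqF// mulrC.
Qed.

End hoelder_moment.

(** * Powers, limits and null sets *)

Section real_powers.
Context {R : realType}.
Implicit Types a b k x p q : R.

Lemma powR_pV a p : 0 <= a -> 0 < p -> (a `^ p) `^ p^-1 = a.
Proof. by move=> a0 p0; rewrite -powRrM mulfV ?gt_eqF// powRr1. Qed.

Lemma ler_powR_root a k x b p : 0 <= a -> 0 <= k -> 0 <= x -> 0 < p ->
  a `^ p <= k * x `^ (b * p) -> a <= k `^ p^-1 * x `^ b.
Proof.
move=> a0 k0 x0 p0 akx; rewrite -(powR_pV a0 p0).
rewrite -[x `^ b](powR_pV _ p0) ?powR_ge0// -powRM ?powR_ge0//.
rewrite -[_ `^ b `^ p]powRrM ge0_ler_powR ?nnegrE ?powR_ge0 ?invr_ge0 ?(ltW p0)//.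
by rewrite mulr_ge0 ?powR_ge0.
Qed.

Lemma ltr_mul_powR L b eps : 0 <= L -> 0 < b -> 0 < eps ->
  exists2 r : R, 0 < r & forall x, 0 <= x -> x < r -> L * x `^ b < eps.
Proof.
move=> L0 b0 eps0; have L1 : 0 < L + 1 by rewrite ltr_wpDl.
pose r := (eps / (L + 1)) `^ b^-1.
exists r; first by rewrite powR_gt0// divr_gt0.
move=> x x0 xr; rewrite (@le_lt_trans _ _ ((L + 1) * x `^ b))//.
  by rewrite ler_wpM2r ?powR_ge0// lerDl.
have -> : eps = (L + 1) * r `^ b.
  by rewrite /r -powRrM mulVf ?gt_eqF// powRr1 ?divr_ge0 ?ltW// mulrC divfK ?gt_eqF.
by rewrite ltr_pM2l// gt0_ltr_powR ?nnegrE ?powR_ge0.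
Qed.

Lemma cvg_powR (u : nat -> R) a p : 0 < a -> u @ \oo --> a ->
  (fun n => u n `^ p) @ \oo --> a `^ p.
Proof.
move=> a0 ua.
have pa : {for a, continuous (fun x => x `^ p)}.
  apply: differentiable_continuous; apply/derivable1_diffP.
  by apply: derivable_powR; rewrite in_itv/= andbT.
exact: (cvg_comp _ _ ua pa).
Qed.

End real_powers.

Section hoelder_limits.
Context {R : realType} {T X : metricType R}.

Lemma cvg_hoelder (z : nat -> T) (u : nat -> X) (x : T) (y : X) (L b : R) :
  0 <= L -> 0 < b -> z @ \oo --> x ->
  (\forall k \near \oo, mdist y (u k) <= L * mdist x (z k) `^ b) ->
  u @ \oo --> y.
Proof.
move=> L0 b0 /cvg_ballP zx uz; apply/cvg_ballP => eps eps0.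
have [r r0 Lr] := ltr_mul_powR L0 b0 eps0.
near=> k; rewrite ballEmdist/=.
have /le_lt_trans : mdist y (u k) <= L * mdist x (z k) `^ b by near: k.
apply; apply: Lr; rewrite ?mdist_ge0//.
have : ball x r (z k) by near: k; exact: zx.
by rewrite ballEmdist.
Unshelve. all: by end_near. Qed.

Lemma cauchy_hoelder (z : nat -> T) (u : nat -> X) (x : T) (S : set T)
    (L b delta : R) :
  0 <= L -> 0 < b -> 0 < delta -> nbhs x S -> z @ \oo --> x ->
  (forall k l, S (z k) -> S (z l) -> mdist (z k) (z l) <= delta ->
    mdist (u k) (u l) <= L * mdist (z k) (z l) `^ b) ->
  cauchy (u @ \oo).
Proof.
move=> L0 b0 delta0 xS zx uz; apply: cauchy_exP => eps eps0.
have [r r0 Lr] := ltr_mul_powR L0 b0 eps0.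
pose c := Num.min r delta / 2.
have c0 : 0 < c by rewrite divr_gt0// lt_min r0.
have [N1 _ N1S] := zx _ xS.
move/cvg_ballP : zx => /(_ c c0)[N2 _ N2z].
have near_z k l : (maxn N1 N2 <= k)%N -> (maxn N1 N2 <= l)%N ->
    [/\ S (z k), S (z l) & mdist (z k) (z l) < Num.min r delta].
  rewrite !geq_max => /andP[k1 k2] /andP[l1 l2].
  split; [exact: N1S|exact: N1S|].
  have := N2z _ k2; have := N2z _ l2; rewrite /= !ballEmdist/= => zl zk.
  rewrite (le_lt_trans (metric_triangle _ x _))// (metric_sym _ x).
  by rewrite [ltRHS]splitr ltrD.
exists (u (maxn N1 N2)); exists (maxn N1 N2) => // k /= Nk.
rewrite ballEmdist/=.
have [Sk SN] := near_z _ _ (leqnn _) Nk.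
rewrite lt_min => /andP[zr zd].
by rewrite (le_lt_trans (uz _ _ Sk SN (ltW zd)))// Lr ?mdist_ge0.
Qed.

End hoelder_limits.

Section almost_sure.
Context {R : realType} {d : measure_display} {Omega : measurableType d}.
Variable P : probability Omega R.

Lemma ae_lt_pinfty (W : Omega -> \bar R) :
  measurable_fun [set: Omega] W -> (forall w, (0 <= W w)%E) ->
  (\int[P]_w W w < +oo)%E -> {ae P, forall w, (W w < +oo)%E}.
Proof.
move=> mW W0 intW.
have iW : P.-integrable [set: Omega] W.
  apply/integrableP; split => //.
  by under eq_integral do rewrite gee0_abs//.
apply: filterS (integrable_ae measurableT iW) => w /(_ I).
by rewrite ge0_fin_numE.
Qed.

Lemma probability_ae (A : set Omega) :
  measurable A -> {ae P, forall w, A w} -> P A = 1%E.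
Proof.
move=> mA /negligibleP => /(_ (measurableC mA)) PA0.
rewrite -[A]setCK probability_setC ?PA0 ?sube0//.
exact: measurableC.
Qed.

End almost_sure.

(** * Covers and dense sequences *)

Section metric_covers.
Context {R : realType} {T : metricType R}.

(** Scales above the diameter are avoided by the choice of [eta0], except when
    [S] has at most one point, where that point is a net at every scale. The
    constant [C + 1] leaves room above the infimum that defines the covering
    number, which provides an actual net. *)
Lemma nets_of_covering (S : set T) (C t rho : R) : 0 < C -> 0 < t -> 0 < rho ->
  (forall eta : R, 0 < eta -> (eta%:E <= diam S)%E ->
    (covering_number S eta <= (C * eta `^ (- t))%:E)%E) ->
  exists2 eta0 : R, [/\ 0 < eta0, eta0 <= 1 & 5 * eta0 < rho] &
    polynomial_nets S (C + 1) t eta0.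
Proof.
move=> C0 t0 rho0 cov.
have etaN eta : 0 < eta -> eta <= 1 -> 1 <= eta `^ (- t).
  move=> e0 e1; rewrite -[leLHS](powRr0 eta) ger_powR ?e0//.
  by rewrite oppr_le0 ltW.
have rho10 : 5 * (rho / 10) < rho.
  by rewrite mulrCA -[ltRHS]mulr1 ltr_pM2l// ltr_pdivrMr// mul1r ltr_nat.
have [[x [y [Sx Sy xy]]]|eqS] :=
    pselect (exists x y, [/\ S x, S y & x != y]); last first.
  exists (Num.min 1 (rho / 10)).
    rewrite lt_min ltr01 divr_gt0// ge_min lexx; split => //.
    by rewrite (le_lt_trans _ rho10)// ler_wpM2l// ge_min lexx orbT.
  move=> eta eta0; rewrite le_min => /andP[eta1 _].
  have [[x Sx]|S0] := pselect (exists x, S x).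
    exists [:: x]; split => /=.
    - by move=> y; rewrite /= inE => /eqP ->.
    - move=> y Sy; exists x; first exact: mem_head.
      have -> : x = y.
        by apply: contrapT => /eqP xy; apply: eqS; exists x, y.
      by rewrite mdistxx ltW.
    - by rewrite mulr_ege1 ?etaN// lerDr ltW.
  exists [::]; split => //=.
  - by move=> x Sx; exfalso; apply: S0; exists x.
  - by rewrite mulr_ge0 ?powR_ge0// addr_ge0// ltW.
exists (Num.min (Num.min 1 (mdist x y)) (rho / 10)).
  rewrite !lt_min ltr01 mdist_gt0 xy divr_gt0// !ge_min lexx; split => //.
  by rewrite (le_lt_trans _ rho10)// ler_wpM2l// ge_min lexx orbT.
move=> eta eta0; rewrite !le_min => /andP[/andP[eta1 etaxy] _].
have diam_ge : (eta%:E <= diam S)%E.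
  rewrite (@le_trans _ _ (mdist x y)%:E)// /diam /sup0.
  by apply: ereal_sup_ubound; right; exists (mdist x y) => //; exists x => //; exists y.
have /ereal_inf_lt[_ [s [sS cs] <-]] :
    (covering_number S eta < ((C + 1) * eta `^ (- t))%:E)%E.
  rewrite (le_lt_trans (cov _ eta0 diam_ge))// lte_fin ltr_pM2r ?powR_gt0//.
  by rewrite ltrDl.
rewrite lte_fin => /ltW ssize.
by exists s; split => // z /cs[c /= sc cz]; exists c.
Qed.

Lemma separable_of_totally_bounded (S : nat -> set T) (x0 : T) :
  (forall n, totally_bounded (S n)) -> \bigcup_n S n = [set: T] ->
  exists e : nat -> T, forall x (eps : R), 0 < eps -> exists i, mdist x (e i) < eps.
Proof.
move=> tbS covS.
have /choice[s Hs] : forall nk : nat * nat, exists s : seq T,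
    S nk.1 `<=` \bigcup_(c in [set` s]) ball c (nk.2.+1%:R^-1 : R).
  move=> [n k]; have [|s [_ sS]] := tbS n (k.+1%:R^-1); last by exists s.
  by rewrite invr_gt0.
pose e m := if unpickle m is Some (nk, i) then nth x0 (s nk) i else x0.
exists e => x eps eps0.
have [n _ Sx] : (\bigcup_n S n) x by rewrite covS.
have [k keps] : exists k, k.+1%:R^-1 < eps :> R.
  exists (Num.truncn eps^-1); rewrite invf_plt ?posrE//.
  exact: truncnS_gt.
have [c /= cs] := Hs (n, k) x Sx; rewrite ballEmdist/= => cx.
exists (pickle ((n, k), index c (s (n, k)))).
by rewrite /e pickleK nth_index// metric_sym (lt_trans cx).
Qed.

End metric_covers.

(** * Hölder continuous paths *)

Section paths.
Context {R : realType} {T X : metricType R}.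

Lemma approximating_indices (e : nat -> T) :
  (forall x (eps : R), 0 < eps -> exists i, mdist x (e i) < eps) ->
  exists z : T -> nat -> nat, forall x, (e \o z x) @ \oo --> x.
Proof.
move=> dense.
have /choice[z zP] : forall xk : T * nat, exists i,
    mdist xk.1 (e i) < xk.2.+1%:R^-1.
  by move=> xk; apply: dense; rewrite invr_gt0.
exists (fun x k => z (x, k)) => x; apply/cvg_ballP => eps eps0.
exists (Num.truncn eps^-1) => // k /= epsk; rewrite ballEmdist/=.
rewrite (lt_trans (zP (x, k)))//= invf_plt ?posrE//.
by rewrite (lt_le_trans (truncnS_gt _))// ler_nat.
Qed.

(** The family indexed by [j] of exponents shares one extension [g], since [g]
    is the limit of [f] along the fixed sequences [z x]. *)
Lemma hoelder_extension (e : nat -> T) (z : T -> nat -> nat)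
    (S : nat -> set T) (f : nat -> X)
    (L b : nat -> nat -> R) (delta : nat -> R) :
  complete_metric X ->
  (forall x, (e \o z x) @ \oo --> x) ->
  (forall n, open (S n)) -> \bigcup_n S n = [set: T] ->
  (forall n j, 0 <= L n j) -> (forall n j, 0 < b n j) ->
  (forall n, 0 < delta n) ->
  (forall n j k l, S n (e k) -> S n (e l) -> mdist (e k) (e l) <= delta n ->
    mdist (f k) (f l) <= L n j * mdist (e k) (e l) `^ b n j) ->
  exists g : T -> X, (forall x, (f \o z x) @ \oo --> g x) /\
    (forall n j x y, S n x -> S n y -> mdist x y < delta n ->
      mdist (g x) (g y) <= L n j * mdist x y `^ b n j).
Proof.
move=> Xc zx oS covS L0 b0 delta0 fL.
have lims : forall x, exists y : X, (f \o z x) @ \oo --> y.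
  move=> x; apply: Xc.
  have [n _ Sx] : (\bigcup_n S n) x by rewrite covS.
  apply: (cauchy_hoelder (S := S n) (L0 n 0%N) (b0 n 0%N) (delta0 n) _ (zx x)).
    by apply: open_nbhs_nbhs; split.
  by move=> k l; exact: fL.
have [g gP] := choice lims.
exists g; split => // n j x y Sx Sy xy.
have [<-|xney] := eqVneq x y.
  by rewrite !mdistxx mulr_ge0// powR_ge0.
have d0 : 0 < mdist x y by rewrite mdist_gt0.
have cd := cvg_mdist (zx x) (zx y).
have cpow : (fun k => L n j * mdist (e (z x k)) (e (z y k)) `^ b n j) @ \oo
    --> L n j * mdist x y `^ b n j.
  by apply: cvgM; [exact: cvg_cst|exact: cvg_powR].
apply: (ler_cvg_to (cvg_mdist (gP x) (gP y)) cpow).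
near=> k; apply: fL.
- by near: k; apply: zx; apply: open_nbhs_nbhs; split.
- by near: k; apply: zx; apply: open_nbhs_nbhs; split.
- by apply: ltW; near: k; exact: (cvgr_lt _ cd).
Unshelve. all: by end_near. Qed.

Lemma locally_hoelder0_continuous (f : T -> X) :
  locally_hoelder 0 f -> continuous f.
Proof.
move=> fH x; have [V xV] := fH x; rewrite /hoelder_on eqxx => fV.
apply/cvg_ballP => eps eps0; have [r r0 Hr] := fV _ eps0.
near=> y; rewrite ballEmdist/=; apply: Hr.
- exact: nbhs_singleton.
- by near: y.
- have : ball x r y by near: y; exact: nbhsx_ballx.
  by rewrite ballEmdist.
Unshelve. all: by end_near. Qed.

(** Lowering the exponent is possible because distances in [V] are at most 1;
    at order 0, the positive exponent [b] gives uniform continuity. *)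
Lemma local_hoelder_bound (V : set T) (f : T -> X) (L b beta : R) :
  0 <= L -> 0 < b -> 0 <= beta -> beta <= b ->
  (forall x y, V x -> V y -> mdist x y <= 1 /\
    mdist (f x) (f y) <= L * mdist x y `^ b) ->
  hoelder_on beta V f.
Proof.
move=> L0 b0 beta0 betab fL; rewrite /hoelder_on; case: ifPn => [_|betan0].
  move=> eps eps0; have [r r0 Hr] := ltr_mul_powR L0 b0 eps0.
  exists r => // x y Vx Vy xy; have [_ /le_lt_trans] := fL _ _ Vx Vy; apply.
  by apply: Hr; rewrite ?mdist_ge0.
exists L => x y Vx Vy; have [xy1 /le_trans] := fL _ _ Vx Vy; apply.
have [->|xney] := eqVneq x y.
  by rewrite mdistxx !powR0 ?gt_eqF// lt_neqAle eq_sym betan0.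
by rewrite ler_wpM2l// ger_powR ?mdist_gt0 ?xney.
Qed.

Context {d : measure_display} {Omega : measurableType d}.

(** By continuity, the supremum is also that over the countably many pairs of
    points of the dense sequence. *)
Lemma measurable_hoelder_quotient_sup (e : nat -> T) (V : set T)
    (Y : T -> Omega -> X) (beta p : R) :
  (forall x (eps : R), 0 < eps -> exists i, mdist x (e i) < eps) ->
  open V -> (forall w, continuous (Y ^~ w)) -> pairwise_measurable Y -> 0 < p ->
  measurable_fun [set: Omega]
    (fun w => hoelder_quotient_sup V beta p (Y ^~ w)).
Proof.
move=> dense oV cY mY p0.
pose quot x y w : R := mdist (Y x w) (Y y w) `^ p / mdist x y `^ (beta * p).
pose F m w : \bar R := if unpickle m is Some (i, j) then
  if `[< [/\ V (e i), V (e j) & e i <> e j] >] then (quot (e i) (e j) w)%:E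
  else 0%E else 0%E.
have mF m : measurable_fun [set: Omega] (F m).
  rewrite /F; case: unpickle => [[i j]|]; last exact: measurable_cst.
  case: asboolP => [[_ _ eij]|_]; last exact: measurable_cst.
  apply/measurable_EFinP/measurable_funM; last exact: measurable_cst.
  apply: (measurableT_comp (measurable_powR p)).
  exact: (measurable_mdist (mY _ _ eij)).
apply: (eq_measurable_fun (fun w => esups (F ^~ w) 0%N)); last first.
  exact: measurable_fun_esups.
move=> w _; set B := esups _ _.
have FB m : (F m w <= B)%E by apply: ereal_sup_ubound; exists m.
have B0 : (0 <= B)%E.
  apply: le_trans (FB (pickle (0%N, 0%N))); rewrite /F pickleK.
  by case: ifPn => // _; rewrite lee_fin divr_ge0// powR_ge0.
apply/eqP; rewrite eq_le; apply/andP; split.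
  apply: ge_ereal_sup => _ [m _ <-]; rewrite /F.
  case: unpickle => [[i j]|]; last by apply: ereal_sup_ubound; left.
  case: asboolP => [[Vi Vj eij]|_]; last by apply: ereal_sup_ubound; left.
  apply: ereal_sup_ubound; right; exists (quot (e i) (e j) w) => //.
  by exists (e i), (e j).
have [z zP] := approximating_indices dense.
apply: ge_ereal_sup => _ [->//|[_ [x [y [Vx Vy xy ->]]] <-]].
(* The power function is only used at positive reals, where it is continuous. *)
have [Yxy|/eqP Yxy] := eqVneq (mdist (Y x w) (Y y w)) 0.
  by rewrite Yxy powR0 ?gt_eqF// mul0r.
have zY u : (fun k => Y (e (z u k)) w) @ \oo --> Y u w.
  exact: (cvg_comp _ _ (zP u) (cY w u)).
have d0 : 0 < mdist x y by rewrite mdist_gt0; exact/eqP.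
have cd := cvg_mdist (zP x) (zP y).
have cquot : (fun k => quot (e (z x k)) (e (z y k)) w) @ \oo --> quot x y w.
  apply: cvgM.
    apply: cvg_powR; first by rewrite lt_neqAle eq_sym mdist_ge0 andbT; exact/eqP.
    exact: cvg_mdist.
  by apply: cvgV; [rewrite gt_eqF// powR_gt0|exact: cvg_powR].
have cquotE : (fun k => (quot (e (z x k)) (e (z y k)) w)%:E) @ \oo
    --> (quot x y w)%:E.
  by apply: cvg_EFin; [exact: nearW|exact: cquot].
apply: (cvge_to_le cquotE).
near=> k; have := FB (pickle (z x k, z y k)).
rewrite /F pickleK asboolT//; split.
- by near: k; apply: zP; apply: open_nbhs_nbhs; split.
- by near: k; apply: zP; apply: open_nbhs_nbhs; split.
- apply/eqP; rewrite -mdist_gt0; near: k; exact: (cvgr_gt _ cd).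
Unshelve. all: by end_near. Qed.

End paths.

(** * The continuity theorem *)

Theorem proposition2p1 (R : realType)
  (Theta : metricType R) (Theta_ : nat -> set Theta) (C t : nat -> R)
  (Theta_tb : forall n, totally_bounded (Theta_ n))
  (Theta_open : forall n, open (Theta_ n))
  (Theta_incr : forall n, Theta_ n `<=` Theta_ n.+1)
  (Theta_cover : \bigcup_n Theta_ n = [set: Theta])
  (C_gt0 : forall n, 0 < C n) (t_gt0 : forall n, 0 < t n)
  (covering : forall (n : nat) (eta : R),
    0 < eta -> (eta%:E <= diam (Theta_ n))%E ->
    (covering_number (Theta_ n) eta <= (C n * eta `^ (- t n))%:E)%E)
  (X : metricType R) (X_complete : complete_metric X)
  (d : measure_display) (Omega : measurableType d) (P : probability Omega R)
  (Xp : Theta -> Omega -> X)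
  (Xp_process : random_process Xp)
  (Xp_pair : pairwise_measurable Xp)
  (M p rho q : nat -> R)
  (M_gt0 : forall n, 0 < M n) (p_gt0 : forall n, 0 < p n)
  (rho_gt0 : forall n, 0 < rho n) (q_gt : forall n, t n < q n)
  (moment : forall (n : nat) (u v : Theta),
    Theta_ n u -> Theta_ n v -> mdist u v < rho n ->
    ('E_P[fun w => (mdist (Xp u w) (Xp v w) `^ p n)%R]
       <= (M n * mdist u v `^ q n)%:E)%E) :
  exists Y : Theta -> Omega -> X,
    [/\ modification P Y Xp,
        pairwise_measurable Y,
        forall (w : Omega) (beta : R), 0 <= beta ->
          (forall n, beta < (q n - t n) / p n) ->
          locally_hoelder beta (fun u => Y u w)
      & forall (n : nat) (u0 : Theta), Theta_ n u0 ->
          exists V : set Theta, [/\ open V, V u0 &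
            forall beta : R, 0 <= beta -> beta < (q n - t n) / p n ->
              let S := fun w => hoelder_quotient_sup V beta (p n) (Y ^~ w) in
              measurable_fun [set: Omega] S /\
              (\int[P]_w S w < +oo)%E]].
Proof.
have [[u0 _]|noTheta] := pselect (exists u : Theta, True); last first.
  exists Xp; split => //.
  - by split => // u; exfalso; apply: noTheta; exists u.
  - by move=> w beta _ _ u; exfalso; apply: noTheta; exists u.
  - by move=> n u; exfalso; apply: noTheta; exists u.
(* The constant value of the modified paths on the exceptional null set. *)
pose x0 := Xp u0 point.
have mXp u v : borel_measurable (fun w => (Xp u w, Xp v w)).
  have [<-|uv] := pselect (u = v); last exact: Xp_pair.
  exact/borel_measurable_diag/Xp_process.
have mdistXp u v := measurable_mdist (mXp u v).
have [e dense] := separable_of_totally_bounded u0 Theta_tb Theta_cover.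
have [z zP] := approximating_indices dense.
have nets n := nets_of_covering (C_gt0 n) (t_gt0 n) (rho_gt0 n) (covering n).
have /choice[delta deltaP] : forall n, exists eta0 : R,
    [/\ 0 < eta0, eta0 <= 1 & 5 * eta0 < rho n] /\
    polynomial_nets (Theta_ n) (C n + 1) (t n) eta0.
  by move=> n; have [eta0] := nets n; exists eta0.
have delta0 n : 0 < delta n by have [[]] := deltaP n.
have delta1 n : delta n <= 1 by have [[]] := deltaP n.
have key (e' : nat -> Theta) n (beta : R) : 0 < beta -> beta < (q n - t n) / p n ->
  exists W, hoelder_majorant P Xp e' (Theta_ n) (delta n) beta (p n) W.
  have [[d0 d1 drho] netsn] := deltaP n.
  have C1 : 0 < C n + 1 by rewrite addr_gt0.
  apply: (hoelder_moment (t_gt0 n) C1 d0 d1 drho (M_gt0 n) (p_gt0 n) (q_gt n)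
    netsn mdistXp).
  by move=> u v nu nv uv; have := moment n u v nu nv uv; rewrite unlock.
pose a n := (q n - t n) / p n.
have a0 n : 0 < a n by rewrite divr_gt0// subr_gt0.
(* Countably many exponents that increase to a n. *)
pose b n j := a n - a n / j.+2%:R.
have b0 n j : 0 < b n j by rewrite subr_gt0 ltr_pdivrMr// ltr_pMr// ltr1n.
have ba n j : b n j < a n by rewrite ltrBlDr ltrDl divr_gt0.
have b_sup n beta : beta < a n -> exists j, beta <= b n j.
  move=> betaa; have ab : 0 < a n - beta by rewrite subr_gt0.
  exists (Num.truncn (a n / (a n - beta))); rewrite /b lerBrDr -lerBrDl.
  rewrite ler_pdivrMr// mulrC -ler_pdivrMr// ltW//.
  by rewrite (lt_le_trans (truncnS_gt _))// ler_nat.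
have /choice[W_ W_P] : forall nj : nat * nat, exists W : Omega -> \bar R,
    hoelder_majorant P Xp e (Theta_ nj.1) (delta nj.1) (b nj.1 nj.2) (p nj.1) W.
  by move=> [n j]; exact: key.
pose Omega0 := [set w | forall n j, (W_ (n, j) w < +oo)%E].
have mOmega0 : measurable Omega0.
  rewrite (_ : Omega0 = \bigcap_n \bigcap_j [set w | (W_ (n, j) w < +oo)%E]).
    apply: bigcap_measurableType => n _; apply: bigcap_measurableType => j _.
    have [mW _ _ _] := W_P (n, j).
    rewrite -[X in measurable X]setTI.
    exact: emeasurable_fun_infty_o.
  apply/seteqP; split => w /=; first by move=> Ww n _ j _; exact: Ww.
  by move=> Ww n j; exact: Ww.
have aeOmega0 : {ae P, forall w, Omega0 w}.
  apply: ae_foralln => n; apply: ae_foralln => j.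
  by have [mW W0 iW _] := W_P (n, j); exact: ae_lt_pinfty.
pose X0 u w := if `[< Omega0 w >] then Xp u w else x0.
have mX0 u v : borel_measurable (fun w => (X0 u w, X0 v w)).
  rewrite (_ : (fun w => _) = fun w => if `[< Omega0 w >]
    then (Xp u w, Xp v w) else (x0, x0)); last first.
    by apply/funext => w; rewrite /X0; case: asboolP.
  apply: borel_measurable_if => //; apply: borel_measurableP => O _.
  by rewrite preimage_cst; case: ifP.
have mX0Xp u v : borel_measurable (fun w => (X0 u w, Xp v w)).
  rewrite (_ : (fun w => _) = fun w => if `[< Omega0 w >]
    then (Xp u w, Xp v w) else (x0, Xp v w)); last first.
    by apply/funext => w; rewrite /X0; case: asboolP.
  apply: borel_measurable_if => //.
  exact/borel_measurable_cst_pair/Xp_process.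
pose L w n j := fine (W_ (n, j) w) `^ (p n)^-1.
have L0 w n j : 0 <= L w n j by rewrite powR_ge0.
have fW0 w n j : 0 <= fine (W_ (n, j) w).
  by have [_ W0 _ _] := W_P (n, j); rewrite fine_ge0.
have X0L w n j k l : Theta_ n (e k) -> Theta_ n (e l) ->
    mdist (e k) (e l) <= delta n ->
    mdist (X0 (e k) w) (X0 (e l) w) <= L w n j * mdist (e k) (e l) `^ b n j.
  move=> nk nl kl; rewrite /X0; case: asboolP => [Ow|_]; last first.
    by rewrite mdistxx mulr_ge0 ?powR_ge0.
  have [_ _ _ HW] := W_P (n, j).
  apply: ler_powR_root; rewrite ?mdist_ge0//.
  by apply: HW => //; exact: Ow.
have /choice[Y' Y'P] : forall w, exists g : Theta -> X,
    (forall x, ((fun k => X0 (e k) w) \o z x) @ \oo --> g x) /\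
    (forall n j x y, Theta_ n x -> Theta_ n y -> mdist x y < delta n ->
      mdist (g x) (g y) <= L w n j * mdist x y `^ b n j).
  move=> w; apply: (hoelder_extension X_complete zP Theta_open Theta_cover) => //.
  by move=> n j k l; exact: X0L.
pose Y u w := Y' w u.
have Ylim u w : (fun k => X0 (e (z u k)) w) @ \oo --> Y u w.
  by have [+ _] := Y'P w => /(_ u).
have YL w n j x y : Theta_ n x -> Theta_ n y -> mdist x y < delta n ->
    mdist (Y x w) (Y y w) <= L w n j * mdist x y `^ b n j.
  by have [_] := Y'P w; exact.
have mYY u v : borel_measurable (fun w => (Y u w, Y v w)).
  apply: (borel_measurable_lim
    (f := fun k w => (X0 (e (z u k)) w, X0 (e (z v k)) w))).
    by move=> k; exact: mX0.
  by move=> w; apply: cvg_pair; exact: Ylim.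
have mYXp u v : borel_measurable (fun w => (Y u w, Xp v w)).
  apply: (borel_measurable_lim (f := fun k w => (X0 (e (z u k)) w, Xp v w))).
    by move=> k; exact: mX0Xp.
  by move=> w; apply: cvg_pair; [exact: Ylim|exact: cvg_cst].
(* The radius depends on n only, not on the exponent beta. *)
pose V n u := Theta_ n `&` (ball u (delta n / 2))°.
have V_open n u : open (V n u) by apply: openI => //; exact: open_interior.
have V_self n u : Theta_ n u -> V n u u.
  by move=> nu; split => //; apply: nbhsx_ballx; rewrite divr_gt0.
have V_small n u x y : V n u x -> V n u y ->
    [/\ Theta_ n x, Theta_ n y & mdist x y < delta n].
  move=> [nx /interior_subset] + [ny /interior_subset].
  rewrite !ballEmdist/= => ux uy; split => //.
  rewrite (le_lt_trans (metric_triangle _ u _))// (metric_sym x).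
  by rewrite [ltRHS]splitr ltrD.
have Yhoelder w n u beta : 0 <= beta -> beta < a n ->
    hoelder_on beta (V n u) (Y ^~ w).
  move=> beta0 /b_sup[j betaj].
  apply: (@local_hoelder_bound _ _ _ _ _ (L w n j) (b n j)) => // x y Vx Vy.
  have [nx ny xy] := V_small _ _ _ _ Vx Vy; split; last exact: YL.
  exact: le_trans (ltW xy) (delta1 n).
have Yloc w beta : 0 <= beta -> (forall n, beta < a n) ->
    locally_hoelder beta (Y ^~ w).
  move=> beta0 betaa u; have [n _ nu] : (\bigcup_n Theta_ n) u by rewrite Theta_cover.
  exists (V n u); last exact: Yhoelder.
  by apply: open_nbhs_nbhs; split => //; exact: V_self.
have Ycont w : continuous (Y ^~ w).
  by apply: locally_hoelder0_continuous; exact: Yloc.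
exists Y; split => //.
- split.
    move=> u; have := @borel_measurable_comp _ _ _ _ _ fst (mYY u u).
    by apply => x; exact: cvg_fst.
  move=> u; have mE : measurable [set w | Y u w = Xp u w].
    exact: (measurable_eq_set (mYXp u u)).
  split => //; apply: probability_ae => //.
  have [n _ nu] : (\bigcup_n Theta_ n) u by rewrite Theta_cover.
  (* The majorant for the sequence u, e 0, e 1, ... compares Xp u with the
     values of Xp along the dense sequence. *)
  pose e' k := if k is k'.+1 then e k' else u.
  have [W [mW W0 iW HW]] := key e' n (b n 0%N) (b0 _ _) (ba _ _).
  apply: filterS2 aeOmega0 (ae_lt_pinfty mW W0 iW) => w Ow Ww.
  have Xlim : (fun k => X0 (e (z u k)) w) @ \oo --> Xp u w.
    apply: (@cvg_hoelder _ _ _ _ _ _ _ (fine (W w) `^ (p n)^-1) (b n 0%N)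
      _ _ (zP u)).
    + exact: powR_ge0.
    + exact: b0.
    near=> k; rewrite /X0 asboolT//.
    apply: ler_powR_root; rewrite ?mdist_ge0 ?fine_ge0//.
    apply: (HW w 0%N (z u k).+1) => //=.
      by near: k; apply: zP; apply: open_nbhs_nbhs; split.
    have : ball u (delta n) ((e \o z u) k).
      by near: k; apply: zP; exact: nbhsx_ballx.
    by rewrite ballEmdist => /ltW.
  exact: (cvg_unique (@metric_hausdorff _ X) (Ylim u w) Xlim).
- move=> n u nu; exists (V n u); split => //; first exact: V_self.
  move=> beta beta0 betaa S.
  have mS : measurable_fun [set: Omega] S.
    exact: (measurable_hoelder_quotient_sup _ dense (V_open n u) Ycont).
  split => //; have [j betaj] := b_sup _ _ betaa.
  have [mW W0 iW _] := W_P (n, j).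
  apply: le_lt_trans iW; apply: ge0_le_integral => //.
    by move=> w _; apply: ereal_sup_ubound; left.
  move=> w _; apply: ge_ereal_sup => _ [->//|[_ [x [y [Vx Vy xy ->]]] <-]].
  have [nx ny xyd] := V_small _ _ _ _ Vx Vy.
  have d0 : 0 < mdist x y by rewrite mdist_gt0; exact/eqP.
  apply: (@le_trans _ _ (fine (W_ (n, j) w))%:E); last first.
    by have := W0 w; case: (W_ (n, j) w).
  rewrite lee_fin ler_pdivrMr ?powR_gt0//.
  apply: (@le_trans _ _ (fine (W_ (n, j) w) * mdist x y `^ (b n j * p n))).
    have -> : fine (W_ (n, j) w) * mdist x y `^ (b n j * p n) =
        (L w n j * mdist x y `^ b n j) `^ p n.
      by rewrite powRM ?powR_ge0// -!powRrM mulVf ?gt_eqF// powRr1.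
    rewrite ge0_ler_powR ?nnegrE ?mdist_ge0 ?mulr_ge0 ?powR_ge0//.
      exact: ltW.
    exact: YL.
  rewrite ler_wpM2l// ger_powR ?d0 ?(le_trans (ltW xyd))//.
  by rewrite ler_wpM2r// ltW.
Unshelve. all: by end_near. Qed.
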